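(* Let $\mathcal{X}$ be a complete separable metric space with Borel sigma field $\mathcal{S}$, let $\mu$ be a probability measure on $(\mathcal{X}, \mathcal{S})$, and let $T$ be an ergodic $\mu$-measure preserving transformation of $(\mathcal{X}, \mathcal{S})$. If $\mathcal{C} \subseteq \mathcal{S}$ is a countable VC-class of measurable sets, and $T$ is strongly mixing, then $$\lim_{n \to \infty} \sup_{A, B \in \mathcal{C}} \left| \mu(A \cap T^{-n} B) - \mu(A)\mu(B) \right| = 0.$$
   Context: A family $\mathcal{C} \subseteq \mathcal{S}$ of measurable sets is a Vapnik-Chervonenkis (VC) class if there is a finite integer $k$ such that $|\{ C \cap D : C \in \mathcal{C} \}| < 2^k$ for every $D \subseteq \mathcal{X}$ with $|D| = k$, where $|\cdot|$ denotes cardinality. The transformation $T$ is strongly mixing if for each pair $A, B$ of measurable sets, $\lim_{n \to \infty} \mu(A \cap T^{-n} B) = \mu(A)\mu(B)$. *)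

(* Defs.v *)
From HB Require Import structures.
From mathcomp Require Import all_boot all_order all_algebra.
From mathcomp Require Import all_classical all_reals all_analysis.

Set Implicit Arguments.
Unset Strict Implicit.
Unset Printing Implicit Defensive.

Import Order.TTheory GRing.Theory Num.Theory.
Import numFieldNormedType.Exports.

Local Open Scope classical_set_scope.
Local Open Scope card_scope.
Local Open Scope ring_scope.

(* [Complete] requires a point; this loses nothing for spaces that carry a
   probability measure, since these are not empty. *)
#[short(type="completeMetricType")]
HB.structure Definition CompleteMetric (R : numDomainType) :=
  {X of Metric R X & Complete X}.

Definition separable (X : topologicalType) : Prop :=
  exists2 D : set X, countable D & dense D.

Notation borel X := (g_sigma_algebraType (@open X)).

Section transformations.
Context (d : measure_display) (X : measurableType d) (R : realType).
Variables (mu : probability X R) (T : X -> X).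

(* [T] need not be invertible: T^-n B is the preimage [iter n T @^-1` B]. *)
Definition measure_preserving : Prop :=
  measurable_fun setT T /\
  forall A : set X, measurable A -> mu (T @^-1` A) = mu A.

Definition ergodic : Prop :=
  forall A : set X, measurable A -> T @^-1` A = A ->
    mu A = 0%E \/ mu A = 1%E.

Definition strongly_mixing : Prop :=
  forall A B : set X, measurable A -> measurable B ->
    mu (A `&` iter n T @^-1` B) @[n --> \oo] --> (mu A * mu B)%E.

End transformations.

Definition vc_class (X : Type) (C : set (set X)) : Prop :=
  exists k : nat, forall D : set X, D #= `I_k ->
    exists2 m : nat, (m < 2 ^ k)%N & [set A `&` D | A in C] #= `I_m.

(* The set under [sup] is bounded by 1, so this is its least upper bound
   unless [C] is empty, in which case it is 0. *)
Definition mixing_discrepancy (d : measure_display) (X : measurableType d)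
    (R : realType) (mu : probability X R) (T : X -> X) (C : set (set X))
    (n : nat) : R :=
  sup [set `|fine (mu (A `&` iter n T @^-1` B)) - fine (mu A) * fine (mu B)|
      | A in C & B in C].

(* Main.v *)
Require Import Defs.
From HB Require Import structures.
From mathcomp Require Import all_boot all_order all_algebra.
From mathcomp Require Import all_classical all_reals all_analysis.
From mathcomp Require Import measurable_realfun zify ring lra.

Set Implicit Arguments.
Unset Strict Implicit.
Unset Printing Implicit Defensive.

Import Order.TTheory GRing.Theory Num.Theory.
Import numFieldNormedType.Exports.

Local Open Scope classical_set_scope.
Local Open Scope ring_scope.

(** Both [A, B |-> mu (A `&` T^-n B)] and [A, B |-> mu A * mu B] are Lipschitz
    for the pseudometric [symdist mu A B], the measure of the symmetric
    difference, and the Lipschitz constant of the former does not depend on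
    [n] because [T] preserves [mu] ([correlation_gap_le]).  Hence the
    convergence given by mixing for each pair of sets is automatically uniform
    over any family that is totally bounded for [symdist], as it suffices to
    control the finitely many pairs taken from a finite net
    ([vc_uniform_mixing]).

    That a VC class is totally bounded is Dudley's argument
    ([vc_separated_bounded]).  Let [m] members of the class be at pairwise
    distance more than [e].  A point of the space lies on average in a
    proportion [e] of the symmetric differences of pairs, so some point
    separates that proportion of any set of pairs ([exists_hitting_point]).
    Choosing such points greedily, the number of pairs not yet separated by
    [n] points is at most [expR (- e) ^+ n * m ^ 2]
    ([exists_hitting_seq]); once this is less than [1], the [m] sets have
    distinct traces on these [n] points.  By the Sauer-Shelah lemma a VC class
    has at most [n.+1 ^ k] traces on [n] points ([vc_class_trace]), and a
    polynomial in [n] does not keep up with [expR e ^+ n]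
    ([expR_beats_poly]), which bounds [m]. *)

(** * The Sauer-Shelah lemma *)

(** A tail comes from one word of [F], or from two when it extends in both
    ways.  This is the recursion behind the Sauer-Shelah lemma. *)
Lemma size_bitseq_family n (F : seq bitseq) :
  uniq F -> all (fun t => size t == n.+1) F ->
  (size F <= size (undup (map behead F)) +
    size [seq t <- undup (map behead F) | (true :: t \in F) && (false :: t \in F)])%N.
Proof.
move=> uF sF; set F0 := undup _.
(* Split [F] by first letter: the two sets of tails have union [F0], and the
   second term counts their intersection. *)
pose Fb b := [seq t <- F0 | b :: t \in F].
have -> : (size F0 + size [seq t <- F0 | (true :: t \in F) && (false :: t \in F)]
    = size (map (cons true) (Fb true) ++ map (cons false) (Fb false)))%N.
  rewrite size_cat !size_map !size_filter -count_predUI; congr addn.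
  apply/esym/eqP; rewrite -all_count; apply/allP => t.
  rewrite mem_undup => /mapP[u uinF ->] /=.
  by move: (allP sF _ uinF) (uinF); case: u {uinF} => // -[] u _ ->; rewrite ?orbT.
apply: uniq_leq_size => // t tF; rewrite mem_cat.
have := allP sF _ tF; case: t tF => // b t tF _.
have tF0 : t \in Fb b.
  by rewrite mem_filter tF mem_undup; apply/mapP; exists (b :: t).
by case: b tF tF0 => tF tF0; rewrite map_f ?orbT.
Qed.

(** Induction on the number [n] of coordinates, the shattered ones being those
    selected by the mask [m]: either the tails are numerous enough to shatter
    [k] coordinates among the last ones, or the tails extending both ways are
    numerous enough to shatter one coordinate less, and the first coordinate
    can then be added. *)
Lemma sauer_shelah n k (F : seq bitseq) :
  uniq F -> all (fun t => size t == n) F -> (n.+1 ^ k < size F)%N ->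
  exists m : bitseq, [/\ size m = n, count id m = k &
    forall w : bitseq, size w = k -> exists2 t, t \in F & mask m t = w].
Proof.
elim: n k F => [|n IHn] k F uF sF ltF.
  have : (size F <= size [:: [::] : bitseq])%N.
    apply: uniq_leq_size => // t /(allP sF) /eqP/size0nil ->.
    by rewrite mem_head.
  by move: ltF; rewrite exp1n /=; case: (size F) => [|[|]].
case: k ltF => [|k] ltF.
  exists (nseq n.+1 false); split.
  - by rewrite size_nseq.
  - by rewrite count_nseq.
  move=> w /size0nil ->; case: F uF sF ltF => // t F _ _ _.
  by exists t; [exact: mem_head | exact: mask_false].
have := size_bitseq_family uF sF.
set F0 := undup _; set F1 := seq.filter _ _ => leF.
have uF0 : uniq F0 by exact: undup_uniq.
have uF1 : uniq F1 by exact: filter_uniq.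
have F0P t : t \in F0 -> size t = n /\ exists b, b :: t \in F.
  rewrite mem_undup => /mapP[u uinF ->].
  move: (allP sF _ uinF) (uinF); case: u {uinF} => //= b u /eqP [->] uF'.
  by split => //; exists b.
have sF0 : all (fun t => size t == n) F0.
  by apply/allP => t /F0P[->].
have sF1 : all (fun t => size t == n) F1.
  by apply/allP => t; rewrite mem_filter => /andP[_ /F0P[->]].
have leE : (n.+1 ^ k.+1 + n.+1 ^ k <= n.+2 ^ k.+1)%N.
  rewrite expnS -mulSnr expnS leq_mul //.
  by case: (posnP k) => [->//|/leq_exp2r ->].
have [lt0|le0] := ltnP (n.+1 ^ k.+1) (size F0).
  have [m [sm cm shm]] := IHn _ _ uF0 sF0 lt0.
  exists (false :: m); split; rewrite /= ?sm //.
  move=> w /shm[t /F0P[_ [b btF]] <-].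
  by exists (b :: t).
have lt1 : (n.+1 ^ k < size F1)%N by lia.
have [m [sm cm shm]] := IHn _ _ uF1 sF1 lt1.
exists (true :: m); split; rewrite /= ?sm ?cm //.
case=> // b w [/shm[t]]; rewrite mem_filter => /andP[/andP[tF fF] _] <-.
by exists (b :: t) => //; case: b.
Qed.

(** * Traces of a VC class *)

Definition trace (X : Type) (s : seq X) (A : set X) : bitseq :=
  [seq x \in A | x <- s].

(** The counting form of the VC property: if there were more traces, the
    Sauer-Shelah lemma would provide [k] of the points on which every word is
    a trace.  These points are then distinct, and all the [2 ^ k] subsets of
    the set [D] that they form would be traces. *)
Lemma vc_class_trace (X : pointedType) (C : set (set X)) :
  vc_class C -> exists k, forall (s : seq X) (F : seq (set X)),
    (forall A, A \in F -> C A) -> uniq [seq trace s A | A <- F] ->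
    (size F <= (size s).+1 ^ k)%N.
Proof.
move=> [k vcC]; exists k => s F FC uF; rewrite leqNgt; apply/negP => ltF.
have sF : all (fun t => size t == size s) [seq trace s A | A <- F].
  by apply/allP => _ /mapP[A _ ->]; rewrite size_map.
rewrite -(size_map (trace s)) in ltF.
have [m [sm cm shm]] := sauer_shelah uF sF ltF.
pose s' := mask m s.
have ss' : size s' = k by rewrite size_mask.
have {}shm w : size w = k -> exists2 A, C A & trace s' A = w.
  move=> /shm[_ /mapP[A AF ->] <-].
  by exists A; [exact: FC | rewrite /trace map_mask].
have us' : uniq s'.
  (* A word that tells the positions [i] and [j] apart is not the trace of any
     set if these positions carry the same point. *)
  apply/negPn/negP => /(uniqPn point)[i [j [ltij ltj]]] eqij.
  have [A _ trA] := shm (mkseq (eq_op^~ i) k) (size_mkseq _ _).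
  have nthA l : (l < k)%N -> (nth point s' l \in A) = (l == i).
    by move=> ltl; rewrite -(nth_mkseq false (eq_op^~ i) ltl) -trA (nth_map point) ?ss'.
  have ltjk : (j < k)%N by rewrite -ss'.
  have := nthA j ltjk.
  by rewrite -eqij nthA ?(ltn_trans ltij) // eqxx gtn_eqF.
pose D : set X := [set nth point s' i | i in `I_k].
have Dk : (D #= `I_k)%card.
  apply: inj_card_eq => i j; rewrite !inE /= -ss' => lti ltj.
  by move/eqP; rewrite nth_uniq // => /eqP.
have [c ltc cardc] := vcC _ Dk.
pose g (S : set X) := [tuple nth point s' i \in S | i < k].
have surjg : [set: k.-tuple bool] `<=` g @` [set A `&` D | A in C].
  move=> w _; have [A CA trA] := shm w (size_tuple w).
  exists (A `&` D); first by exists A.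
  apply: eq_from_tnth => i; rewrite tnth_mktuple (tnth_nth false) -trA.
  rewrite (nth_map point) ?ss' //; apply/idP/idP; rewrite !inE.
    by case.
  by move=> Ai; split => //; exists (i : nat) => //=; exact: ltn_ord.
have card2k : ([set: k.-tuple bool] #= `I_(2 ^ k))%card.
  rewrite -card_bool -card_tuple.
  apply/card_set_bijP; exists (fun w => nat_of_ord (enum_rank w)); split.
  - by move=> w _; exact: ltn_ord.
  - by move=> w w' _ _ /val_inj/enum_rank_inj.
  - by move=> i /= lti; exists (enum_val (Ordinal lti)); rewrite ?enum_valK.
suff : (`I_(2 ^ k) #<= `I_c)%card by rewrite card_le_II leqNgt ltc.
rewrite -(card_le_eql card2k) -(card_le_eqr cardc).
exact: card_le_trans (subset_card_le surjg) (card_image_le _ _).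
Qed.

(** * Separating pairs of sets by few points *)

Lemma expR_beats_poly (R : realType) (e : R) k : 0 < e ->
  exists n, (((n.+1 ^ k).+1 ^ 2)%:R : R) < expR e ^+ n.
Proof.
move=> e0; pose c : R := e ^+ (2 * k).+1 / ((2 * k).+1)`!%:R.
have c0 : 0 < c by rewrite divr_gt0 ?exprn_gt0 // ltr0n fact_gt0.
(* [expR (e * n)] exceeds the term [c * n ^ (2 * k).+1] of its power series,
   while [(n.+1 ^ k).+1 <= 2 * (2 * n) ^ k]. *)
pose x : R := (4 ^ k.+1)%:R / c; pose n := (Num.truncn x).+1.
have cn : (4 ^ k.+1)%:R < c * n%:R.
  by rewrite mulrC -ltr_pdivrMr //; exact: truncnS_gt.
exists n; rewrite -expRM_natr.
have en0 : 0 <= e * n%:R by rewrite mulr_ge0 ?ler0n // ltW.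
apply: lt_le_trans (expR_ge1Dxn (2 * k) en0).
have -> : (e * n%:R) ^+ (2 * k).+1 / ((2 * k).+1)`!%:R
    = c * n%:R * (n ^ (2 * k))%:R by rewrite natrX /c exprMn (exprS n%:R); ring.
have n0 : (0 < n)%N by [].
have le1 : (((n.+1 ^ k).+1 ^ 2) <= 4 ^ k.+1 * n ^ (2 * k))%N.
  have le2 : (n.+1 ^ k <= (2 * n) ^ k)%N.
    case: (posnP k) => [->//|/leq_exp2r ->]; lia.
  have pos : (0 < (2 * n) ^ k)%N by rewrite expn_gt0; lia.
  have -> : (4 ^ k.+1 * n ^ (2 * k) = (2 * (2 * n) ^ k) ^ 2)%N.
    have -> : (n ^ (2 * k) = (n ^ k) ^ 2)%N by rewrite mulnC expnM.
    have E : (4 ^ k = (2 ^ k) ^ 2)%N by rewrite -expnM mulnC expnM.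
    by rewrite expnS E !expnMn mulnA.
  by rewrite leq_sqr; lia.
apply: (@le_lt_trans _ _ ((4 ^ k.+1)%:R * (n ^ (2 * k))%:R)).
  by rewrite -natrM ler_nat.
apply: ltr_wpDl => //; rewrite ltr_pM2r // ltr0n expn_gt0 n0 //.
Qed.

Section hitting.
Context (d : measure_display) (X : measurableType d) (R : realType).
Variable mu : probability X R.
Variables (I : finType) (E : I -> set X) (e : R).
Hypothesis mE : forall i, measurable (E i).
Hypothesis eE : forall i, e < fine (mu (E i)).

(** The number of sets [E i], [i \in P], that contain [x] has mean at least
    [e * #|P|] over [x], so it reaches this value somewhere. *)
Lemma exists_hitting_point (P : {set I}) :
  exists x, e * #|P|%:R <= #|[set i in P | x \in E i]%SET|%:R.
Proof.
have [->|P0] := eqVneq P finset.set0.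
  by exists point; rewrite cards0 mulr0.
have mind i : measurable_fun [set: X] (fun x => (\1_(E i) x : R)%:E).
  by apply/measurable_EFinP; exact: measurable_indic.
apply: contrapT => /forallNP H.
have : (\int[mu]_x (\sum_(i <- enum P) (\1_(E i) x)%:E) <= (e * #|P|%:R)%:E)%E.
  rewrite -[leRHS]mule1 -(probability_setT mu) -integral_cst //.
  apply: ge0_le_integral => //=.
  - by move=> x _; apply: sume_ge0 => i _; rewrite lee_fin.
  - by apply: emeasurable_sum => i; exact: mind.
  - move=> x _; rewrite sumEFin lee_fin; apply/ltW.
    have /negP := H x; rewrite -ltNge; apply: le_lt_trans.
    rewrite big_enum /= -sum1_card natr_sum big_mkcond [leRHS]big_mkcond /=.
    apply: ler_sum => i _; rewrite inE indicE.
    by case: (i \in P); case: (x \in E i).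
rewrite ge0_integral_sum //.
have intE i : (\int[mu]_x (\1_(E i) x)%:E = (fine (mu (E i)))%:E)%E.
  by rewrite fineK ?fin_num_measure // integral_indic // setIT.
under eq_bigr do rewrite intE.
rewrite sumEFin lee_fin big_enum /= leNgt => /negP; apply.
rewrite mulr_natr -sumr_const; apply: ltr_sum => //.
by case/set0Pn: P0 => i iP; apply/hasP; exists i.
Qed.

(** Greedy choice: each new point hits a proportion [e] of the sets that the
    previous points missed, and [1 - e <= expR (- e)]. *)
Lemma exists_hitting_seq n : exists2 s : seq X, size s = n &
  #|[set i | all (fun x => x \notin E i) s]%SET|%:R <= expR (- e) ^+ n * #|I|%:R.
Proof.
elim: n => [|n [s ss les]].
  by exists [::]; rewrite //= expr0 mul1r ler_nat max_card.
set P := finset _ in les; have [x hx] := exists_hitting_point P.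
exists (x :: s); first by rewrite /= ss.
set Q := finset _ in hx.
have -> : [set i | all (fun x => x \notin E i) (x :: s)]%SET = P :\: Q.
  by apply/setP => i; rewrite !inE /=; case: (x \in E i); case: all.
have QP : Q \subset P by apply/fintype.subsetP => i; rewrite inE => /andP[].
rewrite cardsD (finset.setIidPr QP) natrB ?subset_leq_card //.
have step : #|P|%:R - #|Q|%:R <= (1 - e) * #|P|%:R :> R by lra.
apply: le_trans step _; rewrite exprS -mulrA.
apply: le_trans (ler_wpM2l (expR_ge0 _) les).
by rewrite ler_wpM2r ?ler0n // expR_ge1Dx.
Qed.
End hitting.

(** * VC classes are totally bounded *)

Definition symdist d (X : measurableType d) (R : realType)
  (mu : probability X R) (A B : set X) : R := fine (mu (A `+` B)).

Section total_boundedness.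
Context (d : measure_display) (X : measurableType d) (R : realType).
Variables (mu : probability X R) (C : set (set X)).
Hypotheses (mC : C `<=` measurable) (vcC : vc_class C).

(** The bound [N] depends on [e] and the class only: [n] points are chosen so
    that they would separate [N.+1] sets, which then have more traces than the
    VC property allows. *)
Lemma vc_separated_bounded (e : R) : 0 < e -> exists N : nat,
  forall F : seq (set X), (forall A, A \in F -> C A) ->
    pairwise (fun A B => e < symdist mu A B) F -> (size F <= N)%N.
Proof.
move=> e0; have [k vck] := vc_class_trace vcC.
have [n ltn] := expR_beats_poly k e0.
exists (n.+1 ^ k)%N => F0 F0C sepF0; rewrite leqNgt; apply/negP => ltF0.
pose m := (n.+1 ^ k).+1; pose F := take m F0.
have sF : size F = m by rewrite size_takel.
have FC A : A \in F -> C A by move=> /mem_take; exact: F0C.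
have {sepF0} sepF : pairwise (fun A B => e < symdist mu A B) F.
  by apply: subseq_pairwise sepF0; exact: take_subseq.
(* Points hitting all the [E p] separate all the pairs of members of [F]. *)
pose I := {p : 'I_m * 'I_m | (p.1 < p.2)%N}.
pose E (p : I) := nth set0 F (val p).1 `+` nth set0 F (val p).2.
have mF i : (i < m)%N -> measurable (nth set0 F i).
  by move=> ltim; apply/mC/FC/mem_nth; rewrite sF.
have mE p : measurable (E p).
  by apply: measurableU; apply: measurableD; exact/mF/ltn_ord.
have eE p : e < fine (mu (E p)).
  by move/(pairwiseP set0): sepF; apply; rewrite ?inE ?sF ?ltn_ord // (valP p).
have [s ss] := exists_hitting_seq mE eE n.
set P := finset _ => leP.
have P0 : P = finset.set0.
  apply/eqP; rewrite -cards_eq0 -leqn0 -ltnS -(ltr_nat R).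
  apply: le_lt_trans leP _; rewrite expRN exprVn mulrC.
  rewrite ltr_pdivrMr ?exprn_gt0 ?expR_gt0 // mul1r.
  apply: le_lt_trans ltn; rewrite ler_nat card_sig.
  by apply: leq_trans (max_card _) _; rewrite card_prod card_ord.
suff uF : uniq [seq trace s A | A <- F].
  by have := vck s F FC uF; rewrite sF ss ltnn.
apply/negPn/negP => /(uniqPn [::])[i [j [ltij]]]; rewrite size_map => ltj eqij.
have ltjm : (j < m)%N by rewrite -sF.
have ltim : (i < m)%N := ltn_trans ltij ltjm.
pose p : I := exist _ (Ordinal ltim, Ordinal ltjm) ltij.
suff : p \in P by rewrite P0 inE.
rewrite inE; apply/allP => x xs; apply/negP; rewrite inE.
move: eqij; rewrite !(nth_map set0) ?sF // => /eq_in_map/(_ x xs) eqx.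
case=> -[xin]; apply; apply: set_mem.
- by rewrite -eqx; exact: mem_set.
- by rewrite eqx; exact: mem_set.
Qed.

(** Without a finite net, separated families could be extended for ever. *)
Lemma vc_class_totally_bounded (e : R) : 0 < e -> exists F : seq (set X),
  (forall A, A \in F -> C A) /\
  forall A, C A -> exists2 B, B \in F & symdist mu A B <= e.
Proof.
move=> e0; have [N sepN] := vc_separated_bounded e0.
apply: contrapT => /forallNP noF.
have sepF n : exists F : seq (set X), [/\ (forall A, A \in F -> C A),
    pairwise (fun A B => e < symdist mu A B) F & size F = n].
  elim: n => [|n [F [FC sepF sF]]]; first by exists [::].
  have /not_andP[//|/existsNP[A /not_implyP[CA far]]] := noF F.
  exists (A :: F); split; rewrite /= ?sF //.
    by move=> B; rewrite inE => /predU1P[->//|]; exact: FC.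
  rewrite sepF andbT; apply/allP => B BF; rewrite ltNge; apply/negP => le.
  by apply: far; exists B.
have [F [FC sF' sF]] := sepF N.+1.
by have := sepN F FC sF'; rewrite sF ltnn.
Qed.
End total_boundedness.

(** * Uniform mixing *)

Section uniform_mixing.
Context (d : measure_display) (X : measurableType d) (R : realType).
Variable mu : probability X R.
Local Notation pr A := (fine (mu A)).

Lemma prob_le_cover3 (A B D E : set X) : measurable A -> measurable B ->
  measurable D -> measurable E -> A `<=` B `|` D `|` E ->
  pr A <= pr B + pr D + pr E.
Proof.
move=> mA mB mD mE AB.
have fin (Y : set X) : measurable Y -> mu Y \is a fin_num by exact: fin_num_measure.
rewrite -lee_fin !EFinD !fineK ?fin //.
have mBD : measurable (B `|` D) by exact: measurableU.
apply: le_trans (le_measure _ _ _ AB) _; rewrite ?inE //.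
  exact: measurableU.
apply: le_trans (measureU2 _ mBD mE) _; rewrite leeD2r //.
exact: measureU2.
Qed.

Lemma symdistC (A B : set X) : symdist mu A B = symdist mu B A.
Proof. by rewrite /symdist setYC. Qed.

Lemma prob_setI_symdist (A A' B B' : set X) : measurable A -> measurable A' ->
  measurable B -> measurable B' ->
  `|pr (A `&` B) - pr (A' `&` B')| <= symdist mu A A' + symdist mu B B'.
Proof.
have half (A1 A2 B1 B2 : set X) : measurable A1 -> measurable A2 ->
  measurable B1 -> measurable B2 ->
  pr (A1 `&` B1) <= pr (A2 `&` B2) + symdist mu A1 A2 + symdist mu B1 B2.
  move=> mA1 mA2 mB1 mB2.
  have mY (U V : set X) : measurable U -> measurable V -> measurable (U `+` V).
    by move=> mU mV; rewrite setY_def; apply: measurableU; exact: measurableD.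
  apply: prob_le_cover3; [exact: measurableI|exact: measurableI|exact: mY|exact: mY|].
  move=> x [A1x B1x].
  have [A2x|nA2x] := pselect (A2 x); last by left; right; left.
  have [B2x|nB2x] := pselect (B2 x); last by right; left.
  by left; left.
move=> mA mA' mB mB'.
have := half A A' B B' mA mA' mB mB'; have := half A' A B' B mA' mA mB' mB.
rewrite (symdistC A' A) (symdistC B' B) => h1 h2.
rewrite ler_norml; apply/andP; split; lra.
Qed.

Lemma prob_symdist (A B : set X) : measurable A -> measurable B ->
  `|pr A - pr B| <= symdist mu A B.
Proof.
move=> mA mB; have := prob_setI_symdist mA mB (@measurableT _ X) measurableT.
by rewrite !setIT /symdist setYK measure0 addr0.
Qed.

Variable T : X -> X.
Hypothesis Tmp : measure_preserving mu T.

Lemma measure_preserving_iter n : measure_preserving mu (iter n T).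
Proof.
have [mT pT] := Tmp; elim: n => [|n [mTn pTn]].
  by split => [|A _ //]; exact: measurable_id.
split; first exact: (measurableT_comp mT mTn).
move=> A mA; rewrite -[RHS](pT _ mA) -[RHS]pTn //.
by rewrite -[X in measurable X]setTI; exact: mT.
Qed.

(** The constant [2] is the same for all [n]: the preimages of [B] and [B'] are
    as close to each other as [B] and [B'] are. *)
Lemma correlation_gap_le n (A A' B B' : set X) :
  measurable A -> measurable A' -> measurable B -> measurable B' ->
  `|pr (A `&` iter n T @^-1` B) - pr A * pr B|
  <= `|pr (A' `&` iter n T @^-1` B') - pr A' * pr B'|
     + 2 * (symdist mu A A' + symdist mu B B').
Proof.
move=> mA mA' mB mB'; have [mTn pTn] := measure_preserving_iter n.
have mpre (D : set X) : measurable D -> measurable (iter n T @^-1` D).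
  by move=> mD; rewrite -[X in measurable X]setTI; exact: mTn.
have := prob_setI_symdist mA mA' (mpre _ mB) (mpre _ mB').
have -> : symdist mu (iter n T @^-1` B) (iter n T @^-1` B') = symdist mu B B'.
  by rewrite /symdist -[in RHS]pTn // setY_def; apply: measurableU; exact: measurableD.
have := prob_symdist mA mA'; have := prob_symdist mB mB'.
have pr01 (D : set X) : measurable D -> 0 <= pr D <= 1.
  move=> mD; rewrite fine_ge0 //= -lee_fin fineK ?fin_num_measure //.
  exact: probability_le1.
have := pr01 _ mA; have := pr01 _ mB'.
set a := pr A; set a' := pr A'; set b := pr B; set b' := pr B'.
set u := pr (A `&` _); set v := pr (A' `&` _).
set x := symdist _ A A'; set y := symdist _ B B'.
move=> /andP[b0 b1] /andP[a0 a1] hb ha huv.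
have -> : u - a * b = (u - v) + (v - a' * b') + ((a' - a) * b' + a * (b' - b)).
  by ring.
apply: le_trans (ler_normD _ _) _.
have h1 := ler_normD (u - v) (v - a' * b').
have h2 : `|(a' - a) * b' + a * (b' - b)| <= x + y.
  apply: le_trans (ler_normD _ _) _; rewrite !normrM (ger0_norm b0) (ger0_norm a0).
  rewrite (distrC a') (distrC b'); apply: lerD.
    by apply: le_trans ha; rewrite ler_piMr.
  by apply: le_trans hb; rewrite ler_piMl.
lra.
Qed.

(** An [e / 5]-net suffices: the gap at a pair in the class exceeds that at a
    pair in the net by at most [2 * (e / 5 + e / 5)]. *)
Lemma vc_uniform_mixing (C : set (set X)) : C `<=` measurable -> vc_class C ->
  strongly_mixing mu T -> mixing_discrepancy mu T C n @[n --> \oo] --> (0 : R).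
Proof.
move=> mC vcC mixT; apply/cvgrPdist_le => e e0.
have e5 : 0 < e / 5 by rewrite divr_gt0.
have [F [FC netF]] := vc_class_totally_bounded mu mC vcC e5.
pose A i := nth set0 F i.
have CA (i : 'I_(size F)) : C (A i) by apply/FC/mem_nth/ltn_ord.
have : \forall n \near \oo, forall p : 'I_(size F) * 'I_(size F),
    `|pr (A p.1 `&` iter n T @^-1` A p.2) - pr (A p.1) * pr (A p.2)| <= e / 5.
  apply: filter_forall => p.
  have mA1 := mC _ (CA p.1); have mA2 := mC _ (CA p.2).
  have fin (Y : set X) : measurable Y -> mu Y = (pr Y)%:E.
    by move=> mY; rewrite fineK ?fin_num_measure.
  have := mixT _ _ mA1 mA2; rewrite (fin _ mA1) (fin _ mA2) -EFinM.
  move=> /fine_cvg/cvgrPdist_le/(_ _ e5); apply: filterS => n /=.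
  by rewrite distrC.
apply: filterS => n good; rewrite sub0r normrN.
have le_gap (B D : set X) : C B -> C D ->
    `|pr (B `&` iter n T @^-1` D) - pr B * pr D| <= e.
  move=> CB CD.
  have [B' B'F dB] := netF _ CB; have [D' D'F dD] := netF _ CD.
  move: (B'F) (D'F); rewrite -!index_mem => ltB ltD.
  have := good (Ordinal ltB, Ordinal ltD); rewrite /A /= !nth_index //.
  have := correlation_gap_le n (mC _ CB) (mC _ (FC _ B'F)) (mC _ CD) (mC _ (FC _ D'F)).
  lra.
rewrite /mixing_discrepancy; set S := [set _ | _ in _ & _ in _].
have [->|/set0P S0] := eqVneq S set0; first by rewrite sup0 normr0 ltW.
have ubS : ubound S e by move=> _ [B CB [D CD <-]]; exact: le_gap.
rewrite ger0_norm; first exact: ge_sup.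
have [x Sx] := S0; apply: (@le_trans _ _ x).
  by case: Sx => B _ [D _ <-].
by apply: ub_le_sup => //; exists e.
Qed.
End uniform_mixing.

Theorem proposition1 (R : realType) (X : completeMetricType R)
    (sepX : separable X) (mu : probability (borel X) R)
    (T : borel X -> borel X) (C : set (set (borel X))) :
  measure_preserving mu T -> ergodic mu T ->
  C `<=` measurable -> countable C -> vc_class C ->
  strongly_mixing mu T ->
  mixing_discrepancy mu T C n @[n --> \oo] --> (0 : R).
Proof.
by move=> Tmp _ mC _ vcC mixT; exact: vc_uniform_mixing.
Qed.
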